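(* Let $X$ be a proper geodesic $\delta$-hyperbolic metric space, let $b \in \hat{\mathcal{B}}(X)$ with basepoint $\omega \in X \cup \partial X$, and suppose that $X$ is $K$-roughly starlike from $\omega$. Let $\varepsilon > 0$ be such that $\rho_{\varepsilon,b}(x) = e^{-\varepsilon b(x)}$ is a GH-density for $X$ with constant $M$. Let $\mu$ be a Borel measure on $X$ that is doubling on balls of radius at most $R_{0}$ with constant $C_{\mu}$. Then there is $\beta_{0} = \beta_{0}(R_{0},C_{\mu}) > 0$, depending only on $R_{0}$ and $C_{\mu}$, such that if $\beta \geq \beta_{0}$ then the measure $\mu_{\beta,b}$ on $\bar{X}_{\varepsilon,b}$ is doubling with a constant $C_{\mu_{\beta}}$ depending only on $\delta$, $K$, $\varepsilon$, $M$, $\beta$, $R_{0}$ and $C_{\mu}$.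
   Context: A geodesic in a metric space $(X,d)$ is an isometric map $\gamma : I \to X$ of an interval $I \subset \mathbb{R}$; $X$ is geodesic if any two points are joined by a geodesic, and proper if closed balls are compact. A geodesic metric space is $\delta$-hyperbolic ($\delta \ge 0$) if all geodesic triangles are $\delta$-thin: each point of each edge lies within distance $\delta$ of some point on another edge. The Gromov boundary $\partial X$ is the set of geodesic rays $\gamma:[0,\infty)\to X$ modulo the equivalence of being at bounded distance; the class of $\gamma$ is its endpoint. For a geodesic ray $\gamma$, $b_{\gamma}(x) = \lim_{t\to\infty} (d(\gamma(t),x)-t)$. $\mathcal{B}(X) = \{b_{\gamma}+s : \gamma \text{ a geodesic ray in } X,\ s\in\mathbb{R}\}$ (Busemann functions); the basepoint of $b_\gamma+s$ is the endpoint $\omega\in\partial X$ of $\gamma$. For $z \in X$, $b_{z}(x) = d(x,z)$, and $\mathcal{D}(X) = \{b_{z}+s: z\in X, s\in\mathbb{R}\}$; the basepoint of $b_z+s$ is $z$. $\hat{\mathcal{B}}(X) = \mathcal{D}(X)\cup\mathcal{B}(X)$. $X$ is $K$-roughly starlike ($K\ge 0$) from $z\in X$ if for each $x \in X$ there is a geodesic ray $\gamma:[0,\infty)\to X$ with $\gamma(0)=z$ and $\mathrm{dist}(x,\gamma)\le K$. $X$ is $K$-roughly starlike from $\omega\in\partial X$ if for each $x\in X$ there is a geodesic line $\gamma:\mathbb{R}\to X$ such that the ray $t\mapsto\gamma(-t)$, $t \ge 0$, belongs to the class $\omega$ and $\mathrm{dist}(x,\gamma)\le K$. For $b\in\hat{\mathcal{B}}(X)$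 and $\varepsilon>0$, $\rho_{\varepsilon,b}(x)=e^{-\varepsilon b(x)}$, $\ell_{\varepsilon,b}(\gamma)=\int_\gamma\rho_{\varepsilon,b}\,ds$ for a curve $\gamma$, and $X_{\varepsilon,b}$ is the set $X$ with the metric $d_{\varepsilon,b}(x,y)=\inf\ell_{\varepsilon,b}(\gamma)$, the infimum over all curves $\gamma$ joining $x$ to $y$. $\bar X_{\varepsilon,b}$ is its completion and $\partial X_{\varepsilon,b}=\bar X_{\varepsilon,b}\setminus X_{\varepsilon,b}$. $\rho_{\varepsilon,b}$ is a GH-density (Gehring-Hayman density) with constant $M\ge1$ if for all $x,y\in X$ and each geodesic $\gamma$ of $(X,d)$ joining $x$ to $y$, $\ell_{\varepsilon,b}(\gamma)\le M\, d_{\varepsilon,b}(x,y)$. A Borel measure $\mu$ on a metric space is doubling with constant $C_\mu\geq 1$ if $\mu(B(x,2r))\le C_\mu\,\mu(B(x,r))$ for all points $x$ and all $r>0$ (open balls); it is doubling on balls of radius at most $R_0$ if this holds for all $x$ and all $0<r\le R_0$. For $\beta>0$, $\mu_{\beta,b}$ is defined by $d\mu_{\beta,b}(x)=e^{-\beta b(x)}d\mu(x)$ on $X$, extended to $\bar X_{\varepsilon,b}$ by $\mu_{\beta,b}(\partial X_{\varepsilon,b})=0$. *)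

(* Defs.v *)
From HB Require Import structures.
From mathcomp Require Import all_boot all_order all_algebra.
From mathcomp Require Import all_classical all_reals all_analysis.

Set Implicit Arguments.
Unset Strict Implicit.
Unset Printing Implicit Defensive.

Import Order.TTheory GRing.Theory Num.Theory.
Import numFieldNormedType.Exports.

Local Open Scope classical_set_scope.
Local Open Scope ring_scope.

(* The library's measurable types carry a point, so the metric space X is a
   pointed one; the point is never used, and a space that has a basepoint in
   X or a geodesic ray is nonempty anyway. *)
#[short(type="pointedMetricType")]
HB.structure Definition PointedMetric (R : numDomainType) :=
  {M of Pointed M & Metric R M}.

#[short(type="completeMetricType")]
HB.structure Definition CompleteMetric (R : numDomainType) :=
  {M of Complete M & Metric R M}.

Section hyperbolic_spaces.
Context {R : realType} {X : pointedMetricType R}.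
Implicit Types (g : R -> X) (a b t : R) (x y z : X).

Definition proper_space :=
  forall x (r : R), compact [set y | mdist x y <= r].

(* A map defined on an interval I is represented by a function on R, whose
   values outside I are irrelevant. *)
Definition geodesic (I : interval R) g :=
  {in I &, forall s t, mdist (g s) (g t) = `|s - t|}.

Definition geodesic_joining x y a b g :=
  [/\ a <= b, geodesic `[a, b] g, g a = x & g b = y].

Definition geodesic_space := forall x y, exists a b g, geodesic_joining x y a b g.

Definition geodesic_edge x y (E : set X) :=
  exists a b g, geodesic_joining x y a b g /\ E = g @` `[a, b].

Definition within_nbhd (delta : R) (A B : set X) :=
  forall p, A p -> exists2 q, B q & mdist p q <= delta.

Definition thin_triangle (delta : R) (E1 E2 E3 : set X) :=
  [/\ within_nbhd delta E1 (E2 `|` E3),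
      within_nbhd delta E2 (E3 `|` E1) &
      within_nbhd delta E3 (E1 `|` E2)].

Definition hyperbolic (delta : R) :=
  forall x y z (E1 E2 E3 : set X),
    geodesic_edge x y E1 -> geodesic_edge y z E2 -> geodesic_edge z x E3 ->
    thin_triangle delta E1 E2 E3.

Definition geodesic_ray g := geodesic `[0, +oo[ g.

Definition geodesic_line g := geodesic `]-oo, +oo[ g.

Definition bounded_distance g1 g2 :=
  exists C : R, forall t, 0 <= t -> mdist (g1 t) (g2 t) <= C.

Definition endpoint g : set (R -> X) :=
  [set g' | geodesic_ray g' /\ bounded_distance g g'].

Definition gromov_boundary : set (set (R -> X)) :=
  [set endpoint g | g in geodesic_ray].

Definition busemann g x : R := lim ((mdist (g t) x - t) @[t --> +oo]).

Definition busemann_functions : set (X -> R) :=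
  [set h | exists g s, geodesic_ray g /\ h = (fun x => busemann g x + s)].

Definition distance_functions : set (X -> R) :=
  [set h | exists z s, h = (fun x => mdist x z + s)].

Definition Bhat : set (X -> R) := distance_functions `|` busemann_functions.

Definition has_basepoint (h : X -> R) (omega : X + gromov_boundary) :=
  match omega with
  | inl z => exists s, h = (fun x => mdist x z + s)
  | inr xi => exists g s, [/\ geodesic_ray g, endpoint g = \val xi &
                              h = (fun x => busemann g x + s)]
  end.

Definition dist_set x (A : set X) : R := inf [set mdist x y | y in A].

Definition roughly_starlike (K : R) (omega : X + gromov_boundary) :=
  match omega with
  | inl z => forall x, exists g,
      [/\ geodesic_ray g, g 0 = z & dist_set x (g @` `[0, +oo[) <= K]
  | inr xi => forall x, exists g,
      [/\ geodesic_line g, (\val xi) (fun t => g (- t)) &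
          dist_set x (range g) <= K]
  end.

End hyperbolic_spaces.
Arguments proper_space {R} X.
Arguments geodesic_space {R} X.
Arguments hyperbolic {R} X delta.
Arguments gromov_boundary {R} X.

Section conformal_deformation.
Context {R : realType} {X : pointedMetricType R}.
Implicit Types (g : R -> X) (a b t : R) (x y : X) (rho h : X -> R).

Definition curve_joining x y a b g :=
  [/\ a <= b, {within `[a, b], continuous g}, g a = x & g b = y].

Definition curve_length a b g : \bar R :=
  ereal_sup [set (\sum_(0 <= n < size s)
      mdist (g (nth b (a :: s) n)) (g (nth b (a :: s) n.+1)))%:E
    | s in itv_partition a b].

(* The arc length parametrization of the curve g on [a, b]: the value at
   t in [0, length] is the first point at which the length from a reaches t. *)
Definition arc_length_param a b g t : X :=
  g (inf [set u | u \in `[a, b] /\ (t%:E <= curve_length a u g)%E]).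

(* Integral with respect to arc length. For densities bounded below by a
   positive constant on the curve, such as those below, the integral over a
   non-rectifiable curve is infinite. *)
Definition arc_length_integral rho a b g : \bar R :=
  if curve_length a b g == +oo%E then +oo%E else
  (\int[lebesgue_measure]_(t in `[0%R, fine (curve_length a b g)])
     (rho (arc_length_param a b g t))%:E)%E.

Definition conformal_dist rho x y : \bar R :=
  ereal_inf [set l | exists a b g,
    curve_joining x y a b g /\ l = arc_length_integral rho a b g].

Definition exp_density (eps : R) h : X -> R := fun x => expR (- (eps * h x)).

Definition GH_density rho (M : R) :=
  forall x y a b g, geodesic_joining x y a b g ->
    (arc_length_integral rho a b g <= M%:E * conformal_dist rho x y)%E.

(* A complete metric space with a dense isometric copy of (X, d): this
   determines the completion up to isometry over X. *)
Definition is_completion (d : X -> X -> \bar R) (Y : completeMetricType R)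
    (i : X -> Y) :=
  (forall x y, (mdist (i x) (i y))%:E = d x y) /\ dense (range i).

Definition borel := g_sigma_algebraType (@open X).

(* The measure e^(-beta h) dmu on X, extended by 0 to the complement of i(X):
   the part of A outside i(X) does not contribute to the preimage. *)
Definition weighted_measure (mu : {measure set borel -> \bar R}) (beta : R) h
    (Y : completeMetricType R) (i : X -> Y) (A : set Y) : \bar R :=
  (\int[mu]_(x in i @^-1` A) (exp_density beta h x)%:E)%E.

End conformal_deformation.
Arguments borel {R} X.

Section doubling.
Context {R : realType} {T : metricType R}.

Definition doubling_upto (R0 : R) (m : set T -> \bar R) (C : R) :=
  1 <= C /\ forall (x : T) (r : R), 0 < r <= R0 ->
    (m (ball x (2 * r)) <= C%:E * m (ball x r))%E.

Definition doubling (m : set T -> \bar R) (C : R) :=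
  1 <= C /\ forall (x : T) (r : R), 0 < r ->
    (m (ball x (2 * r)) <= C%:E * m (ball x r))%E.

End doubling.

(* Main.v *)
Require Import Defs.
From mathcomp Require Import all_boot all_order all_algebra.
From mathcomp Require Import all_classical all_reals all_analysis.
From mathcomp Require Import measurable_realfun.
From mathcomp Require Import ring lra.

Set Implicit Arguments.
Unset Strict Implicit.
Unset Printing Implicit Defensive.

Import Order.TTheory GRing.Theory Num.Theory.
Import numFieldNormedType.Exports.

Local Open Scope classical_set_scope.
Local Open Scope ring_scope.

(** Write d for the metric of X, D for the deformed one and rho for
    exp (- eps * b). As rho is a GH-density, D x y lies between 1/M times the
    rho-length of a geodesic from x to y and that length, so every estimate
    below is made along geodesics ([conformal_le], [conformal_ge]). The points
    of X are dense in the completion, hence only balls centred in X matter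
    ([doubling_dense]). Fix such a centre x and a radius r.

    If r is small compared with rho x, then the D-balls of radii r and 2 * r
    lie between balls of X about x whose radii are comparable to r / rho x and
    at most R0; there rho is almost constant and mu is doubling
    ([doubling_small_balls]).

    Otherwise move from x towards the basepoint of b, along which rho grows
    exponentially, up to a point q with rho q comparable to r and
    D x q <= r / 4 ([conformal_ascent]); if the basepoint is an interior point
    that is met earlier, the D-ball is the whole space. The D-ball of radius r
    contains a ball of X about q of a fixed radius. For y in the D-ball of
    radius 2 * r, a geodesic from q to y first rises towards the basepoint and
    then descends, by hyperbolicity ([busemann_tripod]); it can rise by a
    bounded amount only, since its rho-length is at most a multiple of rho q.
    So b y >= b q + d q y - C ([conformal_cone]), and the weighted measure of
    the ball is at most a multiple of exp (- beta * b q) times the integral of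
    exp (- beta * d q y). Balls of X grow at most exponentially: enlarging the
    radius by R0 / 4 costs at most a factor Cmu ^+ 3 ([measure_ball_growth]).
    Once beta >= 8 * Cmu ^+ 3 / R0 this growth is absorbed, and the integral
    is at most twice the measure of the ball of radius R0 about q
    ([integral_expR_dist]). Both sides are thus comparable to
    exp (- beta * b q) times the measure of one ball about q
    ([doubling_large_balls]). *)

(** * Busemann functions on hyperbolic spaces *)

Section busemann.
Context {R : realType} {X : pointedMetricType R}.
Implicit Types (g : R -> X) (b : X -> R) (x y z w p q : X) (s t : R).

(** By the triangle inequality d (g t, x) - t is nonincreasing in t >= 0 and
    bounded below by - d (g 0, x). *)
Lemma ray_cvg g x : geodesic_ray g ->
  (mdist (g t) x - t) @[t --> +oo] -->
    inf [set mdist (g t) x - t | t in [set t | 0 <= t]].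
Proof.
move=> gray; set A := [set _ | _ in _].
have gE s t : 0 <= s -> 0 <= t -> mdist (g s) (g t) = `|s - t|.
  by move=> s0 t0; apply: gray; rewrite in_itv /= andbT.
have A0 : A !=set0 by exists (mdist (g 0) x - 0), 0 => /=.
have Alb : has_lbound A.
  exists (- mdist (g 0) x) => _ [t /= t0 <-].
  have := metric_triangle (g 0) x (g t).
  rewrite gE// sub0r normrN ger0_norm// (metric_sym x).
  by move=> ?; lra.
apply/cvgrPdist_le => /= e e0.
have [_ [t0 /= t00 <-] te] := inf_adherent e0 (conj A0 Alb).
near=> t.
have tt0 : t0 <= t by near: t; apply: nbhs_pinfty_ge; exact: num_real.
have t0' : 0 <= t := le_trans t00 tt0.
have Al : inf A <= mdist (g t) x - t by apply: ge_inf => //; exists t.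
have := metric_triangle (g t) (g t0) x.
rewrite gE// ger0_norm ?subr_ge0// => tr.
by rewrite ler_distl; apply/andP; split; lra.
Unshelve. all: by end_near. Qed.

(** A Busemann function is the infimum of shifted distance functions, the
    centres running along the ray; what holds for distance functions passes to
    all of Bhat with an error e. The bound from below holds everywhere by
    monotonicity along the ray, while the bound from above is asked at two
    points only, so that pointwise convergence yields it. The last clause says
    that the centre w is the basepoint or as far away as desired. *)
Lemma busemann_approx b : Bhat b -> forall x y L e, 0 < e ->
  exists w s, [/\ forall p, b p <= mdist p w + s,
    mdist x w + s <= b x + e, mdist y w + s <= b y + e &
    b = (fun p => mdist p w + s) \/ L <= mdist x w].
Proof.
case=> [[z [s ->]] x y L e e0|[g [s [gray ->]]] x y L e e0].
  exists z, s; split => //; [lra|lra|by left].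
have bE p : busemann g p = inf [set mdist (g t) p - t | t in [set t | 0 <= t]].
  by apply/cvg_lim; [exact: Rhausdorff|exact: ray_cvg].
have near_b p : \forall t \near +oo, mdist (g t) p - t <= busemann g p + e.
  have /cvgrPdist_le/(_ _ e0) := @ray_cvg g p gray; rewrite -bE.
  by apply: filterS => t; rewrite ler_distl => /andP[+ _]; lra.
near (pinfty_nbhs R) => t.
have t0 : 0 <= t by near: t; apply: nbhs_pinfty_ge; exact: num_real.
exists (g t), (s - t); split => [p| | |].
- suff : busemann g p <= mdist (g t) p - t by rewrite (metric_sym p); lra.
  rewrite bE; apply: ge_inf; last by exists t.
  exists (- mdist (g 0) p) => _ [u /= u0 <-].
  have := metric_triangle (g 0) p (g u).
  rewrite gray ?in_itv/= ?andbT// sub0r normrN ger0_norm// (metric_sym p).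
  by move=> ?; lra.
- suff : mdist (g t) x - t <= busemann g x + e by rewrite (metric_sym x); lra.
  by near: t; exact: near_b.
- suff : mdist (g t) y - t <= busemann g y + e by rewrite (metric_sym y); lra.
  by near: t; exact: near_b.
- right; have : L + mdist x (g 0) <= t by near: t; apply: nbhs_pinfty_ge; exact: num_real.
  have := metric_triangle (g 0) x (g t); rewrite (metric_sym (g 0) x).
  rewrite gray ?in_itv/= ?andbT// sub0r normrN ger0_norm//.
  by move=> ? ?; lra.
Unshelve. all: by end_near. Qed.

Lemma busemann_lip b : Bhat b -> forall x y, b y <= b x + mdist x y.
Proof.
move=> Hb x y; apply/ler_addgt0Pr => e e0.
have [w [s [ub xw _ _]]] := busemann_approx Hb x x 0 e0.
have := ub y; have := metric_triangle y x w; rewrite (metric_sym y x); lra.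
Qed.

Lemma mdist_geodesic x y a c g t : geodesic_joining x y a c g ->
  a <= t <= c -> mdist x (g t) = t - a /\ mdist (g t) y = c - t.
Proof.
move=> [ac gg <- <-] /andP[at_ tc].
split; rewrite gg ?in_itv/= ?lexx ?ac ?at_ ?tc//.
  by rewrite distrC ger0_norm// subr_ge0.
by rewrite distrC ger0_norm// subr_ge0.
Qed.

Lemma edge_sum x y p (E : set X) : geodesic_edge x y E -> E p ->
  mdist x p + mdist p y = mdist x y.
Proof.
move=> [a [c [g [gj ->]]]] [t /= + <-]; rewrite in_itv/= => tI.
have [-> ->] := mdist_geodesic gj tI.
have [ac _ ga gc] := gj.
have [] := mdist_geodesic gj (_ : a <= c <= c); first by rewrite ac lexx.
by rewrite gc => -> _; lra.
Qed.

Lemma edge_dist_ge x y p p' d (E : set X) : geodesic_edge x y E -> E p' ->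
  mdist p p' <= d -> mdist x p + mdist p y <= mdist x y + 2 * d.
Proof.
move=> /edge_sum /[apply] <- pd.
have := metric_triangle x p' p; have := metric_triangle p p' y.
by rewrite (metric_sym p' p); lra.
Qed.

(** Thinness gives a point of the side [x, y] that is close to both other sides
    of the triangle x, y, w: take the supremum T of the parameters at which the side is
    within delta of [w, x]. Parameters slightly below T give closeness to [w, x], those
    slightly above T give closeness to [y, w]; moving by at most 1 along the
    side explains delta + 1. *)
Lemma internal_point delta x y w a c g : geodesic_space X -> hyperbolic X delta ->
  0 <= delta -> geodesic_joining x y a c g ->
  exists t, [/\ a <= t <= c,
   mdist x (g t) + mdist (g t) w <= mdist x w + 2 * (delta + 1) &
   mdist y (g t) + mdist (g t) w <= mdist y w + 2 * (delta + 1)].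
Proof.
move=> geo hyp d0 gj; have [ac gg ga gc] := gj.
have [a2 [c2 [g2 gj2]]] := geo y w; have [a3 [c3 [g3 gj3]]] := geo w x.
set E1 := g @` `[a, c]; set E2 := g2 @` `[a2, c2]; set E3 := g3 @` `[a3, c3].
have e1 : geodesic_edge x y E1 by exists a, c, g.
have e2 : geodesic_edge y w E2 by exists a2, c2, g2.
have e3 : geodesic_edge w x E3 by exists a3, c3, g3.
have [thin _ _] := hyp _ _ _ _ _ _ e1 e2 e3.
have E3x : E3 x.
  by exists c3; [rewrite /= in_itv/= lexx andbT; case: gj3|case: gj3].
have E2y : E2 y.
  by exists a2; [rewrite /= in_itv/= lexx; case: gj2|case: gj2].
pose near_side (E : set X) u := exists2 q, E q & mdist (g u) q <= delta.
pose S := [set u | a <= u <= c /\ near_side E3 u].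
have Sa : S a.
  by split; [rewrite lexx ac|exists x => //; rewrite ga mdistxx].
have Sub : has_ubound S by exists c => u [/andP[]].
have S0 : S !=set0 by exists a.
have aT : a <= sup S by apply: ub_le_sup.
have Tc : sup S <= c by apply: ge_sup => // u [/andP[]].
have near1 (E : set X) u : a <= u <= c -> near_side E u ->
    `|sup S - u| <= 1 -> exists2 q, E q & mdist (g (sup S)) q <= delta + 1.
  move=> uI [q Eq qd] Tu; exists q => //.
  apply: le_trans (metric_triangle _ (g u) _) _.
  rewrite addrC lerD// gg// in_itv/= ?uI// aT//.
have [q3 E3q q3d] : exists2 q, E3 q & mdist (g (sup S)) q <= delta + 1.
  have [u Su Tu] := sup_adherent ltr01 (conj S0 Sub).
  have uT : u <= sup S by apply: ub_le_sup.
  case: Su => uI uS; apply: near1 uI uS _.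
  by rewrite ger0_norm ?subr_ge0//; lra.
have [q2 E2q q2d] : exists2 q, E2 q & mdist (g (sup S)) q <= delta + 1.
  have [Tc'|cT] := ltP (sup S) c; last first.
    have -> : sup S = c by apply/eqP; rewrite eq_le Tc cT.
    by exists y => //; rewrite gc mdistxx; lra.
  pose u := Num.min c (sup S + 1).
  have Tu : sup S < u by rewrite lt_min Tc' ltrDl ltr01.
  have uc : u <= c by rewrite ge_min lexx.
  have u1 : u <= sup S + 1 by rewrite ge_min lexx orbT.
  have uI : a <= u <= c by rewrite uc andbT; lra.
  apply: (near1 _ u uI); last by rewrite ler0_norm; lra.
  have [|q [E2q'|E3q'] qd] := thin (g u); first by exists u => //=; rewrite in_itv.
    by exists q.
  suff : S u by move=> /(ub_le_sup Sub); rewrite leNgt Tu.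
  by split => //; exists q.
exists (sup S); split; first by rewrite aT Tc.
- have := edge_dist_ge e3 E3q q3d.
  rewrite (metric_sym w (g _)) (metric_sym _ x) (metric_sym w x).
  by lra.
- by have := edge_dist_ge e2 E2q q2d.
Qed.

(** The function b behaves on a geodesic as on a tree: up to a constant, it
    decreases at unit speed from both endpoints to the point g t. The constant
    is twice delta + 1, plus 1 for the approximation of b. *)
Lemma busemann_tripod b delta x y a c g : geodesic_space X ->
  hyperbolic X delta -> 0 <= delta -> Bhat b -> geodesic_joining x y a c g ->
  exists t, [/\ a <= t <= c,
    b (g t) + mdist x (g t) <= b x + (2 * delta + 3) &
    b (g t) + mdist y (g t) <= b y + (2 * delta + 3)].
Proof.
move=> geo hyp d0 Hb gj.
have [w [s [ub xw yw _]]] := busemann_approx Hb x y 0 ltr01.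
have [t [tI h1 h2]] := internal_point w geo hyp d0 gj.
exists t; split => //; have := ub (g t); lra.
Qed.

(** From every point one can move towards the basepoint for a length L, with
    b decreasing at unit speed, unless the basepoint is an interior point w at
    distance at most L. The error 1 replaces the choice of an exact ray to the
    boundary. *)
Lemma busemann_ascent b : geodesic_space X -> Bhat b -> forall x L, 0 <= L ->
  (exists y a c g, [/\ geodesic_joining x y a c g, c - a = L &
      b y <= b x - L + 1]) \/
  (exists w, mdist x w <= L /\ forall y, b y = b w + mdist y w).
Proof.
move=> geo Hb x L L0.
have [w [s [ub xw _ far]]] := busemann_approx Hb x x L ltr01.
have [Lw|wL] := leP L (mdist x w); last first.
  case: far => [bE|]; last by rewrite leNgt wL.
  by right; exists w; split=> [|y]; [exact: ltW|rewrite bE mdistxx; lra].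
left; have [a [c [g gj]]] := geo x w; have [ac gg ga gc] := gj.
have cE : mdist x w = c - a.
  have [] := mdist_geodesic gj (_ : a <= c <= c); first by rewrite ac lexx.
  by rewrite gc.
have LI : a <= a + L <= c by rewrite cE in Lw; apply/andP; split; lra.
exists (g (a + L)), a, (a + L), g; split; [|lra|].
  split => //; first by lra.
  move=> u v; rewrite !in_itv/= => /andP[? ?] /andP[? ?].
  by apply: gg; rewrite in_itv/=; apply/andP; split; lra.
have := ub (g (a + L)); have [_] := mdist_geodesic gj LI.
by lra.
Qed.

End busemann.

(** * Arc length integrals along geodesics *)

Section arc_length.
Context {R : realType} {X : pointedMetricType R}.
Implicit Types (g : R -> X) (b rho : X -> R) (x y z w p q : X) (s t u v : R).

(** The polygonal sums of a geodesic are the variations of the identity. *)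
Lemma curve_length_geodesic x y a c g u : geodesic_joining x y a c g ->
  a <= u <= c -> curve_length a u g = (u - a)%:E.
Proof.
move=> [ac gg _ _] /andP[au uc].
rewrite -(@nondecreasing_total_variation _ a u id)// /curve_length.
rewrite /total_variation /variations image_comp; congr ereal_sup.
apply: eq_imagel => s abs /=; congr EFin; rewrite /variation.
apply: eq_big_nat => n /= ns.
have I m : (m < (size s).+1)%N -> nth u (a :: s) m \in `[a, c].
  move=> ms; rewrite in_itv/= (itv_partition_nth_ge ms abs)/=.
  exact: le_trans (itv_partition_nth_le ms abs) uc.
by rewrite (gg _ _ (I n (ltnW ns)) (I n.+1 ns)) distrC.
Qed.

(** A geodesic is parametrized by arc length up to the shift by a, because the
    set that defines the arc length parameter at t is [a + t, c]. *)
Lemma arc_length_integral_geodesic rho x y a c g :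
  geodesic_joining x y a c g -> arc_length_integral rho a c g =
  (\int[lebesgue_measure]_(t in `[0%R, (c - a)%R]) (rho (g (a + t)))%:E)%E.
Proof.
move=> gj; have [ac _ _ _] := gj.
have -> := @eq_integral _ _ R lebesgue_measure `[0%R, (c - a)%R]
  (fun t => (rho (arc_length_param a c g t))%:E).
  rewrite /arc_length_integral.
  by rewrite (curve_length_geodesic gj) ?ac ?lexx.
move=> t; rewrite inE/= in_itv/= => /andP[t0 tca].
congr (rho _)%:E; rewrite /arc_length_param; congr g.
set A := [set u | _].
have AE u : A u <-> a + t <= u <= c.
  split=> [[]|/andP[au uc]].
    rewrite in_itv/= => uI; rewrite (curve_length_geodesic gj)// lee_fin.
    by case/andP: uI => _ ->; rewrite andbT; lra.
  have uI : a <= u <= c by rewrite uc andbT; lra.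
  split; first by rewrite in_itv.
  by rewrite (curve_length_geodesic gj)// lee_fin; lra.
have At : A (a + t) by apply/AE; rewrite lexx/=; lra.
apply/eqP; rewrite eq_le; apply/andP; split.
  by apply: lb_le_inf; [exists (a + t)|move=> u /AE/andP[]].
by apply: ge_inf At; exists (a + t) => u /AE/andP[].
Qed.

Section density.
Variables (eps : R) (b : X -> R).
Hypothesis eps0 : 0 < eps.
Hypothesis b_lip : forall x y, b y <= b x + mdist x y.

Lemma exp_density_gt0 x : 0 < exp_density eps b x.
Proof. exact: expR_gt0. Qed.

Lemma exp_density_lip x y :
  exp_density eps b y <= expR (eps * mdist x y) * exp_density eps b x.
Proof.
rewrite /exp_density -expRD ler_expR.
have := b_lip y x; rewrite (metric_sym y x) -(ler_pM2l eps0); lra.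
Qed.

(** Clamping the parameter to [a, c] turns the density along the geodesic into
    a continuous function on the line. *)
Lemma measurable_exp_density_geodesic x y a c g : geodesic_joining x y a c g ->
  measurable_fun `[0, c - a]
    (fun t => (exp_density eps b (g (a + t)))%:E).
Proof.
move=> [ac gg _ _]; apply/measurable_EFinP.
pose clamp t := Num.max a (Num.min c (a + t)).
have clampI t : clamp t \in `[a, c].
  by rewrite in_itv/= le_max lexx/= ge_max ac ge_min lexx.
have clamp_lip s t : `|clamp s - clamp t| <= `|s - t|.
  rewrite /clamp ler_norml; have := ler_norm (s - t).
  have := ler_norm (t - s); rewrite (distrC t s).
  by rewrite /Num.max /Num.min; do ![case: ifPn; rewrite -?leNgt] => *;
    apply/andP; split; lra.
apply: (@eq_measurable_fun _ _ _ _ _ (fun t => exp_density eps b (g (clamp t)))).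
  move=> t; rewrite inE/= in_itv/= => /andP[t0 tca].
  rewrite /clamp; congr (exp_density _ _ (g _)).
  by rewrite min_r; [rewrite max_r//; lra|lra].
apply: measurable_funTS; apply: continuous_measurable_fun.
suff bc : continuous (fun t => - (eps * b (g (clamp t)))).
  move=> t; apply: (@continuous_comp _ _ _ (fun t => - (eps * b (g (clamp t)))));
    [exact: bc|exact: continuous_expR].
move=> t; apply: cvgN; apply: cvgMr; apply/cvgrPdist_le => /= e e0.
near=> s.
have st : `|t - s| <= e by near: s; exact: cvgr_dist_le.
apply: le_trans st; apply: le_trans (clamp_lip t s).
have := b_lip (g (clamp t)) (g (clamp s)).
have := b_lip (g (clamp s)) (g (clamp t)).
rewrite !gg// (distrC (clamp s)) => ? ?; rewrite ler_norml.
by apply/andP; split; lra.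
Unshelve. all: by end_near. Qed.

Lemma arc_length_integral_le x y a c g : geodesic_joining x y a c g ->
  (arc_length_integral (exp_density eps b) a c g <=
   ((c - a) * expR (eps * (c - a)) * exp_density eps b x)%:E)%E.
Proof.
move=> gj; have [ac gg ga gc] := gj.
rewrite (arc_length_integral_geodesic _ gj).
set k := expR (eps * (c - a)) * exp_density eps b x.
have -> : (((c - a) * expR (eps * (c - a)) * exp_density eps b x)%:E =
  \int[lebesgue_measure]_(t in `[0%R, (c - a)%R]) (cst k%:E) t)%E.
  rewrite integral_cst//= lebesgue_measure_itv/= lte_fin.
  case: ifPn => [_|]; first by rewrite -EFinD -EFinM; congr EFin; rewrite /k; ring.
  rewrite -leNgt => ?; have -> : c - a = 0 by apply/eqP; rewrite eq_le; lra.
  by rewrite !mul0r mule0.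
apply: ge0_le_integral => //=.
- by move=> t _; rewrite lee_fin ltW// exp_density_gt0.
- exact: measurable_exp_density_geodesic gj.
- move=> t; rewrite in_itv/= => /andP[t0 tca]; rewrite lee_fin.
  apply: le_trans (exp_density_lip x _) _.
  rewrite /k (ler_pM2r (exp_density_gt0 x)) ler_expR (ler_pM2l eps0).
  by have [|-> _] := mdist_geodesic (t := a + t) gj; lra.
Qed.

(** A single piece [u, v] of the geodesic, on which the density is at least
    exp (- eps * (v - u)) times its value at one point, suffices as a lower
    bound. *)
Lemma arc_length_integral_ge x y a c g u v t : geodesic_joining x y a c g ->
  a <= u -> u <= t <= v -> v <= c ->
  (((v - u) * expR (- (eps * (v - u))) * exp_density eps b (g t))%:E <=
   arc_length_integral (exp_density eps b) a c g)%E.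
Proof.
move=> gj au /andP[ut tv] vc; have [ac gg ga gc] := gj.
rewrite (arc_length_integral_geodesic _ gj).
set k := expR (- (eps * (v - u))) * exp_density eps b (g t).
have -> : (((v - u) * expR (- (eps * (v - u))) * exp_density eps b (g t))%:E =
  \int[lebesgue_measure]_(t in `[(u - a)%R, (v - a)%R]) (cst k%:E) t)%E.
  rewrite integral_cst//= lebesgue_measure_itv/= lte_fin.
  case: ifPn => [_|]; first by rewrite -EFinD -EFinM; congr EFin; rewrite /k; ring.
  rewrite -leNgt => ?; have -> : v - u = 0 by apply/eqP; rewrite eq_le; lra.
  by rewrite !mul0r mule0.
have sub : `[u - a, v - a] `<=` `[0, c - a].
  by move=> s /=; rewrite !in_itv/= => /andP[? ?]; lra.
have mf := measurable_exp_density_geodesic gj.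
apply: (@le_trans _ _ (\int[lebesgue_measure]_(t in `[(u - a)%R, (v - a)%R])
   (exp_density eps b (g (a + t)))%:E)%E); last first.
  apply: ge0_subset_integral => // s _.
  by rewrite lee_fin ltW// exp_density_gt0.
apply: ge0_le_integral => //=.
- move=> s _; rewrite lee_fin mulr_ge0 ?expR_ge0// ltW// exp_density_gt0//.
- exact: measurable_funS mf.
- move=> s; rewrite in_itv/= => /andP[su sv]; rewrite lee_fin.
  rewrite /k expRN ler_pdivrMl ?expR_gt0//.
  apply: le_trans (exp_density_lip (g (a + s)) _) _.
  rewrite (ler_pM2r (exp_density_gt0 _)) ler_expR (ler_pM2l eps0).
  rewrite gg ?in_itv/=; [|lra|lra].
  by rewrite ler_norml; lra.
Qed.

End density.

Lemma geodesic_curve x y a c g :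
  geodesic_joining x y a c g -> curve_joining x y a c g.
Proof.
move=> [ac gg ga gc]; split => //.
apply/subspace_continuousP => t tI.
apply/metricType_numDomainType.cvgrPdist_le => e e0; near=> s.
have sI : s \in `[a, c] by near: s; exact: withinT.
rewrite gg//; near: s; apply: cvg_within.
suff : \forall s \near t, `|t - s| <= e by [].
near=> s; near: s; exact: cvgr_dist_le.
Unshelve. all: by end_near. Qed.

End arc_length.

(** * Growth of a locally doubling measure *)

Lemma open_mball {R : realType} {T : metricType R} (x : T) (r : R) :
  open (ball x r).
Proof.
rewrite openE => y; rewrite ballEmdist/= => xy.
rewrite /interior -metricType_numDomainType.filter_from_mdist_nbhs.
exists (r - mdist x y) => /=; first by rewrite subr_gt0.
move=> z /= yz.
by have := metric_triangle x y z; lra.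
Qed.

Section borel_sets.
Context {R : realType} {X : pointedMetricType R}.
Implicit Types (x y z q : X).

Lemma borel_open (A : set X) : open A -> measurable (A : set (borel X)).
Proof. by move=> oA; apply: (@sub_sigma_algebra _ setT (@open X)). Qed.

Lemma measurable_mball x r : measurable (ball x r : set (borel X)).
Proof. by apply: borel_open; exact: open_mball. Qed.

Lemma borel_continuous (f : X -> R) : continuous f ->
  measurable_fun [set: borel X] (f : borel X -> R).
Proof.
move=> /continuousP cf; apply: (measurability _ (RGenOpens.measurableE R)).
move=> _ [_ [a [b ->] <-]]; rewrite setTI.
by apply: borel_open; exact/cf/interval_open.
Qed.

Lemma lip_continuous (f : X -> R) : (forall x y, f y <= f x + mdist x y) ->
  continuous f.
Proof.
move=> f_lip x; apply/cvgrPdist_le => e e0; near=> y.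
have xy : mdist x y <= e.
  near: y; apply/metricType_numDomainType.nbhs_mdistP.
  by exists e => //= y /ltW.
have := f_lip x y; have := f_lip y x; rewrite (metric_sym y x) => ? ?.
by rewrite ler_norml; apply/andP; split; lra.
Unshelve. all: by end_near. Qed.

Lemma borel_expR (k : R) (f : X -> R) : (forall x y, f y <= f x + mdist x y) ->
  measurable_fun [set: borel X] (fun x : borel X => (expR (- (k * f x)))%:E).
Proof.
move=> f_lip; apply/measurable_EFinP; apply: borel_continuous => x.
apply: (@continuous_comp _ _ _ (fun x => - (k * f x)));
  last exact: continuous_expR.
by apply: cvgN; apply: cvgMr; exact: lip_continuous.
Qed.

End borel_sets.

Section growth.
Context {R : realType} {X : pointedMetricType R}.
Variables (mu : {measure set (borel X) -> \bar R}) (R0 C : R).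
Hypothesis R0_gt0 : 0 < R0.
Hypothesis doub : doubling_upto (T := X) R0 mu C.
Implicit Types (x y z q : X) (s : seq X).

Let C1 : 1 <= C. Proof. by case: doub. Qed.
Let C0 : 0 <= C. Proof. exact: le_trans ler01 C1. Qed.

Lemma doubling_iter x r n : 0 < r -> 2 ^+ n * r <= 2 * R0 ->
  (mu (ball x (2 ^+ n * r)) <= (C ^+ n)%:E * mu (ball x r))%E.
Proof.
move=> r0; elim: n => [|n IH] nr; first by rewrite !expr0 !mul1r mul1e.
have pr : 0 < 2 ^+ n * r by rewrite mulr_gt0// exprn_gt0.
rewrite exprS -mulrA in nr *.
apply: le_trans (doub.2 x (2 ^+ n * r) _) _; first by rewrite pr/=; lra.
rewrite exprS EFinM -muleA lee_wpmul2l ?lee_fin//.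
by apply: IH; lra.
Qed.

(** A maximal separated subfamily, chosen greedily. *)
Lemma separated_subseq s d : 0 < d -> exists s', [/\ {subset s' <= s},
  pairwise (fun x y => d <= mdist x y) s' &
  forall x, x \in s -> exists2 y, y \in s' & mdist x y < d].
Proof.
move=> d0; elim: s => [|x s [s' [ss pw net]]]; first by exists [::].
have [far|] := boolP (all (fun y => d <= mdist x y) s').
  exists (x :: s'); split; first 2 last.
  - move=> y; rewrite inE => /predU1P[->|/net[z zs yz]].
      by exists x; rewrite ?mem_head ?mdistxx.
    by exists z => //; rewrite inE zs orbT.
  - by move=> y; rewrite !inE => /predU1P[->|/ss ->]; rewrite ?eqxx ?orbT.
  - by rewrite pairwise_cons far.
move=> /allPn[z zs']; rewrite -ltNge => xz; exists s'; split=> //.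
  by move=> y /ss ys; rewrite inE ys orbT.
by move=> y; rewrite inE => /predU1P[->|/net//]; exists z.
Qed.

(** The balls of radius h about a 2h-separated family are disjoint, and
    enlarging each of them eight times costs three doublings. *)
Lemma measure_separated_balls s h (A : set (borel X)) : 0 < h -> 4 * h <= R0 ->
  measurable A -> pairwise (fun x y => 2 * h <= mdist x y) s ->
  (forall z, z \in s -> ball z h `<=` A) ->
  (mu (\bigcup_(z in [set` s]) ball z (8 * h)) <= (C ^+ 3)%:E * mu A)%E.
Proof.
move=> h0 hR; elim: s A => [|z s IH] A mA.
  move=> _ _; rewrite set_nil bigcup_set0 measure0 mule_ge0 ?measure_ge0//.
  by rewrite lee_fin exprn_ge0.
rewrite pairwise_cons => /andP[/allP far pw] sA.
have mB r := @measurable_mball _ _ z r.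
have mU : measurable (\bigcup_(x in [set` s]) ball x (8 * h) : set (borel X)).
  by apply: borel_open; apply: bigcup_open => x _; exact: open_mball.
have -> : [set` z :: s] = z |` [set` s].
  by apply/seteqP; split=> x /=; rewrite inE => /predU1P.
rewrite bigcup_setU1.
apply: (@le_trans _ _ (mu (ball z (8 * h)) +
    mu (\bigcup_(x in [set` s]) ball x (8 * h)))%E); first exact: measureU2.
have -> : A = ball z h `|` (A `\` ball z h).
  by rewrite setDUK//; apply: sA; rewrite mem_head.
have mD : measurable (A `\` ball z h) by apply: measurableD.
rewrite measureU//; last by rewrite setDIK.
rewrite ge0_muleDr ?measure_ge0//; apply: leeD.
  have -> : 8 * h = 2 ^+ 3 * h by ring.
  by apply: doubling_iter => //; rewrite (_ : 2 ^+ 3 = 8); [lra|ring].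
apply: IH => // x xs y xy; split.
  by apply: sA xy; rewrite inE xs orbT.
move=> zy; have := far x xs; rewrite leNgt => /negP; apply.
rewrite ballEmdist/= in xy; rewrite ballEmdist/= in zy.
by have := metric_triangle z y x; rewrite (metric_sym y x); lra.
Qed.

Hypothesis geo : geodesic_space X.
Hypothesis proper : proper_space X.

Lemma proper_net q r h : 0 < h -> exists s : seq X,
  {in s, forall z, mdist q z <= r} /\
  forall y, mdist q y <= r -> exists2 z, z \in s & mdist z y < h.
Proof.
move=> h0; have := @proper q r; rewrite compact_cover => cov.
have [] := cov X [set y | mdist q y <= r] (fun z => ball z h).
- by move=> z _; exact: open_mball.
- by move=> y yr; exists y => //; rewrite ballEmdist/= mdistxx.
move=> D DK Dcov; exists (finmap.enum_fset D); split.
  by move=> z /DK; rewrite inE.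
by move=> y /Dcov[z zD]; rewrite ballEmdist/= => zy; exists z.
Qed.

(** With h := R0 / 4, the centres of a maximal 2h-separated family in the
    closed ball of radius r - h have disjoint h-balls inside the r-ball, while
    their 8h-balls cover the (r + h)-ball because X is geodesic. *)
Lemma measure_ball_growth q r : R0 <= r ->
  (mu (ball q (r + R0 / 4)) <= (C ^+ 3)%:E * mu (ball q r))%E.
Proof.
move=> rR0; set h := R0 / 4.
have h0 : 0 < h by rewrite divr_gt0.
have hE : 4 * h = R0 by rewrite /h; field.
have [s [sr net]] := proper_net q (r - h) h0.
have [|s' [ss sep net']] := separated_subseq s (d := 2 * h); first by lra.
apply: (@le_trans _ _ (mu (\bigcup_(z in [set` s']) ball z (8 * h)))).
  apply: le_measure; rewrite ?inE.
  - exact: measurable_mball.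
  - by apply: borel_open; apply: bigcup_open => z _; exact: open_mball.
  move=> y; rewrite ballEmdist/= => qy.
  (* pull y back along a geodesic from q into the closed (r - h)-ball *)
  have [y' [y'1 y'2]] : exists y', mdist q y' <= r - h /\ mdist y' y < 2 * h.
    have [qy'|qy'] := leP (mdist q y) (r - h).
      by exists y; split => //; rewrite mdistxx; lra.
    have [a [c [g gj]]] := geo q y; have [ac gg ga gc] := gj.
    have [|_] := mdist_geodesic (t := a) gj; first by rewrite lexx.
    rewrite ga => E.
    have [|E1 E2] := mdist_geodesic (t := a + (r - h)) gj; first by lra.
    by exists (g (a + (r - h))); rewrite E1 E2; split; lra.
  have [z zs zy'] := net _ y'1; have [z' zs' zz'] := net' _ zs.
  exists z' => //; rewrite ballEmdist/=.
  have := metric_triangle z' z y; have := metric_triangle z y' y.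
  by rewrite (metric_sym z' z); lra.
apply: measure_separated_balls => //; [lra|exact: measurable_mball|].
move=> z /ss zs y; rewrite !ballEmdist/= => zy.
by have := metric_triangle q z y; have := sr z zs; lra.
Qed.

Lemma measure_ball_exp_growth q n :
  (mu (ball q (R0 + n%:R * (R0 / 4))) <= ((C ^+ 3) ^+ n)%:E * mu (ball q R0))%E.
Proof.
elim: n => [|n IH]; first by rewrite mul0r addr0 expr0 mul1e.
rewrite -natr1 mulrDl mul1r addrA.
apply: le_trans (measure_ball_growth _ _) _.
  by rewrite lerDl mulr_ge0// ltW// divr_gt0.
have -> : (((C ^+ 3) ^+ n.+1)%:E = (C ^+ 3)%:E * ((C ^+ 3) ^+ n)%:E)%E.
  by rewrite -EFinM -exprS.
by rewrite -muleA lee_wpmul2l// lee_fin exprn_ge0.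
Qed.

Lemma geometric_sum_le n : \sum_(0 <= k < n) (2^-1 : R) ^+ k <= 2.
Proof.
rewrite big_mkord.
have -> : \sum_(k < n) (2^-1 : R) ^+ k = 2 - 2 * 2^-1 ^+ n.
  elim: n => [|n IH]; first by rewrite big_ord0 expr0; ring.
  by rewrite big_ord_recr/= IH exprS; field.
by rewrite gerBl mulr_ge0// exprn_ge0.
Qed.

(** The integrand is dominated by a sum over n of exp (- beta * n * h) times the
    indicator of the ball of radius R0 + n * h. Exponential growth bounds the
    n-th term by (C ^+ 3 * exp (- beta * h)) ^+ n, and the threshold on beta
    makes the ratio at most 1/2. *)
Lemma integral_expR_dist q beta : 8 * C ^+ 3 / R0 <= beta ->
  (\int[mu]_(y in [set: borel X]) (expR (- (beta * mdist q y)))%:E <=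
   2%:E * mu (ball q R0))%E.
Proof.
move=> hbeta; set h := R0 / 4.
have h0 : 0 < h by rewrite divr_gt0.
have hR : h <= R0 by rewrite /h; have R0' := R0_gt0; lra.
have C30 : 0 < C ^+ 3 by rewrite exprn_gt0// (lt_le_trans ltr01).
have beta0 : 0 < beta by apply: lt_le_trans hbeta; rewrite divr_gt0// mulr_gt0.
(* 1 + beta * h >= 2 * C ^+ 3 already bounds expR (beta * h) from below *)
have decay : C ^+ 3 * expR (- (beta * h)) <= 2^-1.
  rewrite expRN ler_pdivrMr ?expR_gt0// mulrC.
  have := expR_ge1Dx (beta * h).
  rewrite ler_pdivrMr// in hbeta.
  have -> : beta * h = beta * R0 / 4 by rewrite /h; ring.
  by lra.
pose f n y : \bar R := ((expR (- (beta * h)) ^+ n)%:E *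
  (\1_(ball q (R0 + n%:R * h)) y)%:E)%E.
have f0 n y : (0 <= f n y)%E.
  by rewrite mule_ge0// lee_fin ?exprn_ge0 ?expR_ge0.
have mf n : measurable_fun [set: borel X] (f n).
  apply/measurable_EFinP => /=; apply: measurable_funM => //.
  by apply: measurable_indic; exact: measurable_mball.
have le_f y : ((expR (- (beta * mdist q y)))%:E <= \sum_(n <oo) f n y)%E.
  pose n := Num.truncn (mdist q y / h).
  have /andP[n1 n2] : (n%:R <= mdist q y / h < n.+1%:R).
    by apply: truncn_itv; rewrite divr_ge0 ?mdist_ge0// ltW.
  rewrite ler_pdivlMr// in n1; rewrite ltr_pdivrMr// in n2.
  apply: le_trans (nneseries_lim_ge n.+1 _) => //.
  rewrite big_nat_recr//=.
  apply: (@le_trans _ _ (f n y)); last by rewrite leeDr// sume_ge0.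
  rewrite /f indicE mem_set; last first.
    rewrite ballEmdist/=; apply: lt_le_trans n2 _; rewrite -natr1 mulrDl mul1r.
    by rewrite addrC lerD2r.
  rewrite mule1 lee_fin -expRM_natl ler_expR mulrN lerN2.
  by rewrite -(ler_pM2l beta0) in n1; lra.
apply: (@le_trans _ _ (\int[mu]_(y in [set: borel X]) \sum_(n <oo) f n y)%E).
  apply: ge0_le_integral => //.
  - apply: borel_expR => x y; exact: metric_triangle.
  - exact: ge0_emeasurable_sum.
rewrite integral_nneseries//.
apply: lime_le; first by apply: is_cvg_nneseries => n _ _; exact: integral_ge0.
near=> N.
apply: (@le_trans _ _ (\sum_(0 <= n < N) ((2^-1 ^+ n)%:E * mu (ball q R0)))%E).
  apply: lee_sum => n _.
  rewrite ge0_integralZl//; last first.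
    by apply/measurable_EFinP; apply: measurable_indic; exact: measurable_mball.
  rewrite integral_indic//; last exact: measurable_mball.
  rewrite setIT.
  apply: (@le_trans _ _ ((expR (- (beta * h)) ^+ n)%:E *
     (((C ^+ 3) ^+ n)%:E * mu (ball q R0)))%E).
    rewrite lee_wpmul2l ?lee_fin ?exprn_ge0 ?expR_ge0//.
    exact: measure_ball_exp_growth.
  rewrite muleA -EFinM -exprMn_comm; last exact: mulrC.
  rewrite lee_wpmul2r ?measure_ge0// lee_fin lerXn2r// ?nnegrE ?mulr_ge0 ?expR_ge0 ?exprn_ge0//.
  by rewrite mulrC.
rewrite -ge0_sume_distrl; last by move=> n _; rewrite lee_fin exprn_ge0.
rewrite lee_wpmul2r ?measure_ge0// sumEFin lee_fin.
exact: geometric_sum_le.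
Unshelve. all: by end_near. Qed.

End growth.

(** * Weighted measures *)

Section weight.
Context {R : realType} {X : pointedMetricType R}.
Variables (mu : {measure set (borel X) -> \bar R}) (b : X -> R) (beta : R).
Hypothesis beta0 : 0 < beta.
Hypothesis b_lip : forall x y, b y <= b x + mdist x y.
Implicit Types (x y z q : X) (s : R) (E : set (borel X)).

Let mw E : measurable E ->
  measurable_fun E (fun x : borel X => (exp_density beta b x)%:E).
Proof. by move=> mE; apply: measurable_funTS; exact: borel_expR. Qed.

Lemma weight_ge E q s : measurable E -> ball q s `<=` E ->
  ((exp_density beta b q * expR (- (beta * s)))%:E * mu (ball q s) <=
   \int[mu]_(x in E) (exp_density beta b x)%:E)%E.
Proof.
move=> mE sE; have mB := @measurable_mball _ _ q s.
apply: (@le_trans _ _ (\int[mu]_(x in (ball q s : set (borel X)))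
    (exp_density beta b x)%:E)%E); last first.
  apply: ge0_subset_integral => //; first exact: mw.
  by move=> x _; rewrite lee_fin expR_ge0.
rewrite -integral_cst//; apply: ge0_le_integral => //.
- by move=> x _; rewrite lee_fin mulr_ge0 ?expR_ge0.
- exact: mw.
- move=> x; rewrite ballEmdist/= => qx; rewrite lee_fin -expRD ler_expR.
  have := b_lip q x => h; have : b x <= b q + s by lra.
  by rewrite -(ler_pM2l beta0); lra.
Qed.

Lemma weight_le_ball E q s : measurable E -> E `<=` ball q s ->
  (\int[mu]_(x in E) (exp_density beta b x)%:E <=
   (exp_density beta b q * expR (beta * s))%:E * mu (ball q s))%E.
Proof.
move=> mE sE; have mB := @measurable_mball _ _ q s.
apply: (@le_trans _ _ (\int[mu]_(x in (ball q s : set (borel X)))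
    (exp_density beta b x)%:E)%E).
  apply: ge0_subset_integral => //; first exact: mw.
  by move=> x _; rewrite lee_fin expR_ge0.
rewrite -integral_cst//; apply: ge0_le_integral => //.
- by move=> x _; rewrite lee_fin expR_ge0.
- exact: mw.
- move=> x; rewrite ballEmdist/= => qx; rewrite lee_fin -expRD ler_expR.
  have := b_lip x q; rewrite (metric_sym x q) => h.
  have : b q <= b x + s by lra.
  by rewrite -(ler_pM2l beta0); lra.
Qed.

(** The set E looks like a cone with apex q in which b grows at unit speed; the
    weight of such a set is concentrated near the apex. *)
Lemma weight_le_cone E q s R0 Cmu : geodesic_space X -> proper_space X ->
  0 < R0 -> doubling_upto (T := X) R0 mu Cmu -> 8 * Cmu ^+ 3 / R0 <= beta ->
  measurable E -> (forall y, E y -> b q + mdist q y <= b y + s) ->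
  (\int[mu]_(x in E) (exp_density beta b x)%:E <=
   (2 * (exp_density beta b q * expR (beta * s)))%:E * mu (ball q R0))%E.
Proof.
move=> geo proper R00 doub betaC mE cone.
set k := exp_density beta b q * expR (beta * s).
have k0 : 0 <= k by rewrite mulr_ge0 ?expR_ge0.
have md D : measurable D ->
    measurable_fun D (fun y : borel X => (expR (- (beta * mdist q y)))%:E).
  move=> mD; apply: measurable_funTS.
  by apply: borel_expR => x y; exact: metric_triangle.
apply: (@le_trans _ _ (\int[mu]_(y in E)
    (k%:E * (expR (- (beta * mdist q y)))%:E))%E).
  apply: ge0_le_integral => //.
  - by move=> y _; rewrite lee_fin expR_ge0.
  - exact: mw.
  - by apply: emeasurable_funM => //; exact: md.
  - move=> y /cone; rewrite -(ler_pM2l beta0) => h.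
    by rewrite -EFinM lee_fin /k -!expRD ler_expR; lra.
rewrite ge0_integralZl//; last exact: md.
apply: (@le_trans _ _ (k%:E * (2%:E * mu (ball q R0)))%E); last first.
  by rewrite muleA -EFinM mulrC.
rewrite lee_wpmul2l ?lee_fin//.
apply: le_trans (integral_expR_dist R00 doub geo proper q betaC).
by apply: ge0_subset_integral => //; exact: md.
Qed.

End weight.

(** * The deformed metric and its balls *)

Section uniformization.
Context {R : realType} {X : pointedMetricType R}.
Variables (b : X -> R) (eps M delta : R).
Hypotheses (eps0 : 0 < eps) (M1 : 1 <= M) (delta0 : 0 <= delta).
Hypotheses (geo : geodesic_space X) (hyp : hyperbolic X delta) (Hb : Bhat b).
Hypothesis GH : GH_density (exp_density eps b) M.
Variables (Y : completeMetricType R) (i : X -> Y).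
Hypothesis compl : is_completion (conformal_dist (exp_density eps b)) i.
Implicit Types (x y z w p q : X) (g : R -> X) (t u v r : R).

Local Notation rho := (exp_density eps b).
Local Notation D x y := (mdist (i x) (i y)).

Let b_lip := busemann_lip Hb.
Let rho0 x : 0 < rho x. Proof. exact: expR_gt0. Qed.

Let conformalE x y : (D x y)%:E = conformal_dist rho x y.
Proof. exact: compl.1. Qed.

Lemma conformal_le x y :
  D x y <= mdist x y * expR (eps * mdist x y) * rho x.
Proof.
have [a [c [g gj]]] := geo x y; have [ac gg ga gc] := gj.
have [_ E] : mdist x (g a) = a - a /\ mdist (g a) y = c - a.
  by apply: (mdist_geodesic gj); rewrite lexx.
rewrite ga in E.
rewrite -lee_fin conformalE E; apply: le_trans (arc_length_integral_le eps0 b_lip gj).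
by apply: ereal_inf_lbound; exists a, c, g; split => //; exact: geodesic_curve.
Qed.

Lemma conformal_ge x y a c g u v t : geodesic_joining x y a c g ->
  a <= u -> u <= t <= v -> v <= c ->
  (v - u) * expR (- (eps * (v - u))) * rho (g t) <= M * D x y.
Proof.
move=> gj au utv vc; rewrite -lee_fin (EFinM M) conformalE.
apply: le_trans (GH gj).
exact: arc_length_integral_ge gj au utv vc.
Qed.

Let density_le x y : rho y <= expR (eps * mdist x y) * rho x.
Proof. exact: exp_density_lip. Qed.

(** The sum of the geometric series of ratio exp (- eps). *)
Definition radial_const := (1 - expR (- eps))^-1.

Lemma radial_const_ge1 : 1 <= radial_const.
Proof.
have e1 : expR (- eps) < 1 by rewrite expR_lt1 oppr_lt0.
by rewrite /radial_const invf_ge1 ?subr_gt0// gerBl expR_ge0.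
Qed.

(** Along a geodesic from x the density grows at most like exp (eps * t); summing
    over steps of length 1, counted back from y, the D-length is dominated by
    its last terms. Unlike in [conformal_le], the factor d x y is absent: this
    is what keeps D x q comparable to rho q after an ascent of any length. *)
Lemma conformal_le_radial x y :
  D x y <= radial_const * (expR (eps * mdist x y) * rho x).
Proof.
have A1 := radial_const_ge1.
have AE : radial_const * expR (- eps) + 1 = radial_const.
  have e1 : expR (- eps) < 1 by rewrite expR_lt1 oppr_lt0.
  by rewrite /radial_const; field; rewrite gt_eqF ?subr_gt0.
have [n] : exists n, mdist x y <= n%:R.
  exists (Num.truncn (mdist x y)).+1.
  by apply: ltW; rewrite -truncn_le_nat.
elim: n x y => [|n IH] x y xyn.
  apply: le_trans (conformal_le x y) _.
  have -> : mdist x y = 0 by apply/eqP; rewrite eq_le xyn mdist_ge0.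
  by rewrite !mul0r !mulr_ge0 ?expR_ge0 ?(le_trans ler01 A1)// ltW.
have [xy1|xy1] := leP (mdist x y) 1.
  apply: le_trans (conformal_le x y) _; rewrite -mulrA ler_wpM2r//.
    by rewrite mulr_ge0 ?expR_ge0// ltW.
  exact: le_trans xy1 A1.
have [a [c [g gj]]] := geo x y; have [ac gg ga gc] := gj.
have [|_] := mdist_geodesic (t := a) gj; first by rewrite lexx.
rewrite ga => E.
have [|E1 E2] := mdist_geodesic (t := c - 1) gj; first by lra.
set z := g (c - 1) in E1 E2.
have xz : mdist x z = mdist x y - 1 by rewrite E1 E; ring.
have zy : mdist z y = 1 by rewrite E2; ring.
apply: le_trans (metric_triangle _ (i z) _) _.
have h1 : D x z <= radial_const * (expR (eps * (mdist x y - 1)) * rho x).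
  by rewrite -xz; apply: IH; rewrite xz; rewrite -natr1 in xyn; lra.
have h2 : D z y <= expR eps * (expR (eps * (mdist x y - 1)) * rho x).
  apply: le_trans (conformal_le z y) _; rewrite zy mul1r mulr1.
  by rewrite ler_pM2l ?expR_gt0// -xz; exact: density_le.
have E3 : expR (eps * (mdist x y - 1)) = expR (- eps) * expR (eps * mdist x y).
  by rewrite -expRD; congr expR; ring.
rewrite E3 in h1 h2.
have E4 : expR eps * expR (- eps) = 1 by rewrite -expRD subrr expR0.
apply: le_trans (lerD h1 h2) _.
set k := expR (eps * mdist x y) * rho x.
rewrite [leLHS](_ : _ = (radial_const * expR (- eps) + 1) * k); last first.
  rewrite -E4 /k; ring.
by rewrite AE.
Qed.

Lemma conformal_continuous : continuous i.
Proof.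
move=> x; apply/metricType_numDomainType.cvgrPdist_le => e e0; near=> y.
have k0 : 0 < expR eps * rho x by rewrite mulr_gt0 ?expR_gt0.
have xy1 : mdist x y <= 1.
  near: y; apply/metricType_numDomainType.nbhs_mdistP.
  by exists 1 => //= y /ltW.
have xye : mdist x y <= e / (expR eps * rho x).
  near: y; apply/metricType_numDomainType.nbhs_mdistP.
  have d0 : 0 < e / (expR eps * rho x) by rewrite divr_gt0// mulr_gt0 ?expR_gt0.
  exists (e / (expR eps * rho x)); first exact: d0.
  by move=> y /ltW.
apply: le_trans (conformal_le x y) _.
rewrite ler_pdivlMr// in xye; apply: le_trans xye.
rewrite -mulrA ler_wpM2l ?mdist_ge0// ler_pM2r// ler_expR.
by rewrite ger_pMr.
Unshelve. all: by end_near. Qed.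

Lemma measurable_preimage_ball (z : Y) r :
  measurable (i @^-1` ball z r : set (borel X)).
Proof.
apply: borel_open; apply: open_comp; last exact: open_mball.
by move=> x _; exact: conformal_continuous.
Qed.

(** On a geodesic from q to y take the tripod point p. If p is at distance more
    than 1 from q, the piece of length 1 just before p has rho-length at least
    exp (- eps) * rho p, which M * D q y bounds; hence b p is not much smaller
    than b q, and b rises from there to y at unit speed. *)
Lemma conformal_cone C2 q y : 0 <= C2 -> D q y <= C2 * rho q ->
  b q + mdist q y <= b y + 2 * (1 + M * C2 / eps + (2 * delta + 3)).
Proof.
move=> C20 qy; set C3 := 1 + M * C2 / eps.
have [a [c [g gj]]] := geo q y; have [ac gg ga gc] := gj.
have [t [tI bq by_]] := busemann_tripod geo hyp delta0 Hb gj.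
have [E1 E2] := mdist_geodesic gj tI.
set p := g t in bq by_ E1 E2.
suff bp : b q <= b p + C3.
  have := metric_triangle q p y; rewrite (metric_sym p y) => ?; lra.
have [qp1|qp1] := leP (mdist q p) 1.
  have := b_lip p q; rewrite (metric_sym p q).
  have : 0 <= M * C2 / eps by rewrite !mulr_ge0// ?invr_ge0 ?ltW// (lt_le_trans ltr01).
  by rewrite /C3; lra.
have := @conformal_ge q y a c g (t - 1) t t gj.
have -> : t - (t - 1) = 1 by ring.
rewrite mul1r mulr1 -/p => H.
have {}H : expR (- eps) * rho p <= M * D q y.
  by apply: H; [lra|rewrite lexx andbT; lra|lra].
have {}H : expR (- eps) * rho p <= M * C2 * rho q.
  apply: le_trans H _; rewrite -mulrA ler_pM2l//.
  by rewrite (lt_le_trans ltr01).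
(* M * C2 <= expR (M * C2) avoids a logarithm in the constant *)
have key : expR (- eps) * rho p <= expR (M * C2) * rho q.
  apply: le_trans H _; rewrite ler_pM2r//.
  by have := expR_ge1Dx (M * C2); lra.
rewrite /exp_density -!expRD ler_expR in key.
rewrite -(ler_pM2l eps0).
have -> : eps * (b p + C3) = eps * b p + eps + M * C2.
  by rewrite /C3; field; rewrite gt_eqF.
lra.
Qed.

(** If rho x is already comparable to r, then q := x. Otherwise the ascent has
    the length L for which rho would be multiplied up to c * r, with
    c := 1 / (4 * radial_const) so that the D-length stays below r / 4. If it
    meets an interior basepoint w first, then rho w <= c * r, and every point
    is at D-distance at most r / 4 from w, where rho is largest. *)
Lemma conformal_ascent u0 x r : 0 < u0 -> u0 <= 1 -> 0 < r ->
  rho x <= r / u0 ->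
  (exists q, [/\ D x q <= r / 4,
     expR (- eps) * (4 * radial_const)^-1 * r <= rho q & rho q <= r / u0]) \/
  (forall y, D x y < r).
Proof.
move=> u00 u01 r0 xr; set c := (4 * radial_const)^-1.
have A1 := radial_const_ge1; have A0 : 0 < radial_const by apply: lt_le_trans A1.
have c0 : 0 < c by rewrite invr_gt0 mulr_gt0.
have cA : radial_const * c = 4^-1 by rewrite /c; field; rewrite gt_eqF.
have ru : r <= r / u0 by rewrite ler_pdivlMr// ger_pMr.
have crr : c * r <= r.
  rewrite ger_pMl// /c invf_le1 ?mulr_gt0//; lra.
have [xc|xc] := leP (c * r) (rho x).
  left; exists x; split => //; first by rewrite mdistxx divr_ge0// ltW.
  apply: le_trans xc; rewrite -mulrA ger_pMl ?mulr_gt0//.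
  by rewrite expR_le1 oppr_le0 ltW.
pose L := ln (c * r / rho x) / eps.
have L1 : 1 < c * r / rho x by rewrite ltr_pdivlMr// mul1r.
have L0 : 0 <= L by rewrite divr_ge0 ?ltW// ln_gt0.
have eL : expR (eps * L) * rho x = c * r.
  rewrite /L mulrCA mulfV ?gt_eqF// mulr1 lnK ?posrE ?divrK ?gt_eqF//.
    by rewrite unitf_gt0.
  exact: lt_trans L1.
have [[q [a [d [g [gj dL bq]]]]]|[w [xw top]]] := busemann_ascent geo Hb x L0.
  have [ac gg ga gc] := gj.
  have [|_] := mdist_geodesic (t := a) gj; first by rewrite lexx.
  rewrite ga dL => xq.
  left; exists q; split.
  - apply: le_trans (conformal_le_radial x q) _.
    by rewrite xq eL mulrA cA mulrC.
  - rewrite -mulrA -eL mulrA /exp_density -!expRD ler_expR.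
    by rewrite -(ler_pM2l eps0) in bq; lra.
  - apply: le_trans (density_le x q) _; rewrite xq eL.
    exact: le_trans crr ru.
right=> y.
have rw : rho w <= c * r.
  apply: le_trans (density_le x w) _; rewrite -eL ler_pM2r// ler_expR.
  by rewrite ler_pM2l.
have Dw z : D z w <= r / 4.
  apply: le_trans (conformal_le_radial z w) _.
  have -> : expR (eps * mdist z w) * rho z = rho w.
    by rewrite /exp_density -expRD top; congr expR; ring.
  apply: le_trans (ler_wpM2l (ltW A0) rw) _.
  by rewrite mulrA cA mulrC.
have := metric_triangle (i x) (i w) (i y); rewrite (metric_sym (i w) (i y)).
have := Dw x; have := Dw y; lra.
Qed.

Variables (mu : {measure set (borel X) -> \bar R}) (R0 Cmu beta : R).
Hypotheses (R00 : 0 < R0) (doub : doubling_upto (T := X) R0 mu Cmu).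
Hypothesis proper : proper_space X.
Hypothesis betaC : 8 * Cmu ^+ 3 / R0 <= beta.

Let Cmu1 : 1 <= Cmu. Proof. by case: doub. Qed.
Let beta0 : 0 < beta.
Proof.
apply: lt_le_trans betaC.
by rewrite divr_gt0// mulr_gt0// exprn_gt0// (lt_le_trans ltr01).
Qed.

Local Notation W x r := (weighted_measure mu beta b i (ball (i x) r)).

(** The ball of X of radius s' := exp (- eps) * r / rho x lies in the D-ball of
    radius r, and the ball of radius 2 ^+ N * s' contains the D-ball of radius
    2 * r: on a piece of a geodesic of length at most 1 that starts at x, rho
    differs from rho x by a factor between exp (- eps) and exp eps. *)
Lemma doubling_small_balls N u0 x r : 0 < r ->
  2 * M * expR eps * expR eps <= 2 ^+ N -> u0 * (2 * M * expR eps) <= 1 ->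
  2 ^+ N * u0 <= R0 -> r <= u0 * rho x ->
  (W x (2 * r) <= (expR (2 * (beta * R0)) * Cmu ^+ N)%:E * W x r)%E.
Proof.
move=> r0 MN uM uN ru.
have M0 : 0 < M by apply: lt_le_trans M1.
set s' := expR (- eps) * (r / rho x).
have ru' : r / rho x <= u0 by rewrite ler_pdivrMr.
have rr0 : 0 < r / rho x by rewrite divr_gt0.
have s'0 : 0 < s' by rewrite mulr_gt0 ?expR_gt0.
have e1 : expR (- eps) <= 1 by rewrite expR_le1 oppr_le0 ltW.
have E1 : expR eps * expR (- eps) = 1 by rewrite -expRD subrr expR0.
have s'r : s' <= r / rho x by rewrite /s' ger_pMl.
have N1 : 1 <= 2 ^+ N :> R by rewrite exprn_ege1// ler1n.
have N0 : 0 < 2 ^+ N :> R by apply: lt_le_trans N1.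
have sR : 2 ^+ N * s' <= R0.
  by apply: le_trans uN; rewrite ler_pM2l//; apply: le_trans ru'.
have s'R : s' <= R0 by apply: le_trans sR; rewrite ler_peMl// ltW.
have u1 : u0 <= 1.
  have u00 : 0 < u0 by apply: lt_le_trans ru'.
  suff : u0 * 1 <= 1 by rewrite mulr1.
  apply: le_trans uM; rewrite ler_pM2l//.
  have h : 1 <= expR eps by rewrite -expR0 ler_expR ltW.
  have : 1 * 1 <= M * expR eps by rewrite ler_pM.
  lra.
have inner : ball x s' `<=` i @^-1` ball (i x) r.
  move=> y; rewrite ballEmdist/= => xy; rewrite /preimage/= ballEmdist/=.
  apply: le_lt_trans (conformal_le x y) _.
  have rx := rho0 x.
  have xy1 : mdist x y <= 1.
    by rewrite (le_trans (ltW xy))// (le_trans s'r)// (le_trans ru').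
  apply: (@le_lt_trans _ _ (mdist x y * (expR eps * rho x))).
    rewrite -mulrA ler_wpM2l ?mdist_ge0// ler_pM2r// ler_expR ger_pMr//.
  rewrite -ltr_pdivlMr ?mulr_gt0 ?expR_gt0//; apply: lt_le_trans xy _.
  rewrite le_eqVlt; apply/orP; left; apply/eqP; rewrite /s' expRN.
  by field; rewrite !gt_eqF ?expR_gt0.
(* the first unit of a geodesic is too long already if y is far from x *)
have outer : i @^-1` ball (i x) (2 * r) `<=` ball x (2 ^+ N * s').
  move=> y; rewrite /preimage/= !ballEmdist/= => xy.
  have [a [c [g gj]]] := geo x y; have [ac gg ga gc] := gj.
  have [|_] := mdist_geodesic (t := a) gj; first by rewrite lexx.
  rewrite ga => E.
  pose l := Num.min 1 (mdist x y).
  have l0 : 0 <= l by rewrite le_min ler01 mdist_ge0.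
  have l1 : l <= 1 by rewrite ge_min lexx.
  have ld : l <= mdist x y by rewrite ge_min lexx orbT.
  have := @conformal_ge x y a c g a (a + l) a gj.
  rewrite ga addrAC subrr add0r => H.
  have {}H : l * expR (- (eps * l)) * rho x <= M * D x y.
    by apply: H; [exact: lexx|rewrite lexx lerDl|lra].
  have {}H : l * expR (- eps) * rho x < M * (2 * r).
    apply: (@le_lt_trans _ _ (M * D x y)); last by rewrite ltr_pM2l.
    apply: le_trans H; rewrite ler_pM2r// ler_wpM2l// ler_expR lerN2.
    by rewrite ger_pMr.
  have {}H : l < 2 * M * expR eps * (r / rho x).
    rewrite -(ltr_pM2r (expR_gt0 (- eps))) -(ltr_pM2r (rho0 x)).
    apply: lt_le_trans H _; rewrite le_eqVlt; apply/orP; left; apply/eqP.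
    transitivity (2 * M * r * (expR eps * expR (- eps))).
      by rewrite E1; ring.
    by field; rewrite gt_eqF.
  have ls : l < 2 ^+ N * s'.
    apply: lt_le_trans H _.
    have -> : 2 * M * expR eps * (r / rho x) = 2 * M * expR eps * expR eps * s'.
      rewrite /s' -!mulrA [expR eps * (expR (- eps) * _)]mulrA E1 mul1r.
      by ring.
    by rewrite ler_pM2r.
  have ll1 : l < 1.
    apply: lt_le_trans H _; apply: le_trans uM; rewrite mulrC ler_pM2r//.
    by rewrite !mulr_gt0 ?expR_gt0.
  by move: ll1 ls; rewrite /l minEle; case: ifPn => // _; rewrite ltxx.
have mp := measurable_preimage_ball.
apply: (le_trans (weight_le_ball mu beta0 b_lip (mp _ _) outer)).
have lower := weight_ge mu beta0 b_lip (mp _ _) inner.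
apply: (@le_trans _ _ ((expR (2 * (beta * R0)) * Cmu ^+ N)%:E *
  ((exp_density beta b x * expR (- (beta * s')))%:E * mu (ball x s')))%E);
  last by rewrite lee_wpmul2l// lee_fin mulr_ge0 ?expR_ge0// exprn_ge0//
    (le_trans ler01).
apply: (@le_trans _ _ ((exp_density beta b x * expR (beta * (2 ^+ N * s')))%:E *
   ((Cmu ^+ N)%:E * mu (ball x s')))%E).
  rewrite lee_wpmul2l ?lee_fin ?mulr_ge0 ?expR_ge0//.
  apply: (doubling_iter doub) => //.
  by rewrite (le_trans sR)// mulr2n; have := R00; lra.
rewrite !muleA -!EFinM lee_wpmul2r ?measure_ge0// lee_fin.
rewrite [leRHS](_ : _ = exp_density beta b x *
   (expR (2 * (beta * R0)) * expR (- (beta * s'))) * Cmu ^+ N); last by ring.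
rewrite ler_wpM2r ?exprn_ge0 ?(le_trans ler01)//.
rewrite ler_wpM2l ?expR_ge0// -expRD ler_expR.
by rewrite -(ler_pM2l beta0) in sR; rewrite -(ler_pM2l beta0) in s'R; lra.
Qed.

(** Both sides are compared with the ball of X about q of radius
    s0 = R0 / 2 ^+ N, so small that this ball lies within D-distance r / 2 of q;
    N doublings lead from it to the radius R0. *)
Lemma doubling_large_balls N k kappa x q r : 0 < r -> 0 < kappa ->
  D x q <= r / 4 -> kappa * r <= rho q -> rho q <= k * r ->
  R0 / 2 ^+ N <= 1 -> k * expR eps * (R0 / 2 ^+ N) <= 2^-1 ->
  (W x (2 * r) <= (2 * expR (beta * (2 * (1 + M * (3 / kappa) / eps +
     (2 * delta + 3)) + R0 / 2 ^+ N)) * Cmu ^+ N)%:E * W x r)%E.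
Proof.
move=> r0 kappa0 xq qlow qup; set s0 := R0 / 2 ^+ N => s01 ks.
have N0 : 0 < 2 ^+ N :> R by rewrite exprn_gt0.
have s00 : 0 < s0 by rewrite divr_gt0.
have inner : ball q s0 `<=` i @^-1` ball (i x) r.
  move=> y; rewrite ballEmdist/= => qy; rewrite /preimage/= ballEmdist/=.
  have h1 : D q y <= s0 * (expR eps * rho q).
    apply: le_trans (conformal_le q y) _; rewrite -mulrA.
    apply: ler_pM; rewrite ?mdist_ge0 ?mulr_ge0 ?expR_ge0 ?(ltW qy)//.
    rewrite ler_pM2r// ler_expR ger_pMr//; exact: le_trans (ltW qy) s01.
  have h2 : s0 * (expR eps * rho q) <= r / 2.
    apply: (@le_trans _ _ (s0 * (expR eps * (k * r)))).
      by rewrite ler_pM2l// ler_pM2l ?expR_gt0.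
    rewrite -(ler_pM2r r0) in ks.
    rewrite [leLHS](_ : _ = k * expR eps * s0 * r); last by ring.
    by rewrite [leRHS]mulrC.
  by have := metric_triangle (i x) (i q) (i y); lra.
have cone y : (i @^-1` ball (i x) (2 * r)) y ->
   b q + mdist q y <= b y + 2 * (1 + M * (3 / kappa) / eps + (2 * delta + 3)).
  rewrite /preimage/= ballEmdist/= => xy.
  apply: conformal_cone; first by rewrite divr_ge0// ltW.
  apply: (@le_trans _ _ (3 * r)).
    have := metric_triangle (i q) (i x) (i y).
    by rewrite (metric_sym (i q) (i x)); lra.
  by rewrite mulrAC ler_pdivlMr// -mulrA ler_pM2l// mulrC.
have mp := measurable_preimage_ball.
apply: (le_trans (weight_le_cone beta0 b_lip geo proper R00 doub betaC (mp _ _) cone)).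
have lower := weight_ge mu beta0 b_lip (mp _ _) inner.
set C1 := 2 * (1 + _ + _).
set k1 := 2 * expR _ * _.
have k10 : 0 <= k1.
  by rewrite /k1 !mulr_ge0 ?expR_ge0 ?exprn_ge0// (le_trans ler01).
apply: (@le_trans _ _ (k1%:E * ((exp_density beta b q *
   expR (- (beta * s0)))%:E * mu (ball q s0)))%E); last by rewrite lee_wpmul2l.
have qs : (mu (ball q R0) <= (Cmu ^+ N)%:E * mu (ball q s0))%E.
  have RE : R0 = 2 ^+ N * s0 by rewrite /s0; field; rewrite gt_eqF.
  rewrite {1}RE; apply: (doubling_iter doub) => //.
  by rewrite -RE; have := R00; lra.
apply: (@le_trans _ _ ((2 * (exp_density beta b q * expR (beta * C1)))%:E *
   ((Cmu ^+ N)%:E * mu (ball q s0)))%E).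
  by rewrite lee_wpmul2l// lee_fin !mulr_ge0 ?expR_ge0.
rewrite !muleA -!EFinM lee_wpmul2r ?measure_ge0// lee_fin.
rewrite le_eqVlt; apply/orP; left; apply/eqP.
rewrite /k1 mulrDr expRD.
have E1 : expR (beta * s0) * expR (- (beta * s0)) = 1.
  by rewrite -expRD subrr expR0.
transitivity (2 * (exp_density beta b q * expR (beta * C1)) * Cmu ^+ N *
   (expR (beta * s0) * expR (- (beta * s0)))); first by rewrite E1 mulr1.
by ring.
Qed.

End uniformization.

(** * Transfer to the completion *)

Lemma pow2_ge {R : realType} (a : R) : exists n, a <= 2 ^+ n.
Proof.
exists (Num.truncn a).+1; apply: (@le_trans _ _ ((Num.truncn a).+1%:R)).
  by apply: ltW; rewrite -truncn_le_nat.
by rewrite -natrX ler_nat ltnW// ltn_expl.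
Qed.

(** A centre y is replaced by some i x at distance less than r / 2: the ball of
    radius r about y contains the ball of radius r / 2 about i x, and the ball of
    radius 2 * r lies in that of radius 2 ^+ 3 * (r / 2). *)
Lemma doubling_dense {R : realType} {X : Type} (Y : completeMetricType R)
    (i : X -> Y) (m : set Y -> \bar R) (C : R) : dense (range i) -> 1 <= C ->
  (forall (y z : Y) (r s : R), ball y r `<=` ball z s ->
    (m (ball y r) <= m (ball z s))%E) ->
  (forall (x : X) (r : R), 0 < r ->
    (m (ball (i x) (2 * r)) <= C%:E * m (ball (i x) r))%E) ->
  doubling m (C ^+ 3).
Proof.
move=> di C1 mono doub; split; first exact: exprn_ege1.
have C0 : (0 <= C%:E)%E by rewrite lee_fin (le_trans ler01).
move=> y r r0.
have [||w [yw [x _ xw]]] := di (ball y (r / 2)).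
- by exists y; apply: ballxx; rewrite divr_gt0.
- exact: open_mball.
move: yw; rewrite -xw ballEmdist/= => yx.
apply: (@le_trans _ _ (m (ball (i x) (2 * (2 * (2 * (r / 2))))))).
  apply: mono => z; rewrite !ballEmdist/= => yz.
  by have := metric_triangle (i x) y z; rewrite (metric_sym (i x) y); lra.
apply: (@le_trans _ _ ((C ^+ 3)%:E * m (ball (i x) (r / 2)))%E); last first.
  rewrite lee_wpmul2l ?lee_fin ?exprn_ge0 ?(le_trans ler01)//.
  apply: mono => z; rewrite !ballEmdist/= => xz.
  by have := metric_triangle y (i x) z; lra.
have -> : ((C ^+ 3)%:E = C%:E * (C%:E * C%:E))%E by rewrite -!EFinM; congr EFin; ring.
rewrite -!muleA; apply: le_trans (doub _ _ _) _; first by rewrite !mulr_gt0.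
rewrite lee_wpmul2l//; apply: le_trans (doub _ _ _) _; first by rewrite !mulr_gt0.
by rewrite lee_wpmul2l//; apply: doub; rewrite divr_gt0.
Qed.

Theorem theorem1p2 (R : realType) (R0 Cmu : R) (hR0 : 0 < R0) (hCmu : 1 <= Cmu) :
  exists beta0 : R, 0 < beta0 /\
  forall delta K eps M beta : R,
    0 <= delta -> 0 <= K -> 0 < eps -> 1 <= M -> beta0 <= beta ->
  exists Cmubeta : R,
  forall (X : pointedMetricType R) (b : X -> R) (omega : X + gromov_boundary X)
    (mu : {measure set (borel X) -> \bar R}),
    proper_space X -> geodesic_space X -> hyperbolic X delta ->
    Bhat b -> has_basepoint b omega ->
    roughly_starlike K omega ->
    GH_density (exp_density eps b) M ->
    doubling_upto (T := X) R0 mu Cmu ->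
  forall (Xbar : completeMetricType R) (i : X -> Xbar),
    is_completion (conformal_dist (exp_density eps b)) i ->
    doubling (weighted_measure mu beta b i) Cmubeta.
Proof.
exists (8 * Cmu ^+ 3 / R0); split.
  by rewrite divr_gt0// mulr_gt0// exprn_gt0// (lt_le_trans ltr01).
move=> delta K eps M beta delta0 K0 eps0 M1 betaC.
have M0 : 0 < M by apply: lt_le_trans M1.
have Cmu0 : 0 <= Cmu by apply: le_trans hCmu.
have ee : 0 < expR eps := expR_gt0 _.
have Me : 0 < 2 * M * expR eps by rewrite !mulr_gt0.
have [N1 hN1] := pow2_ge (2 * M * expR eps * expR eps).
have P1 : 0 < 2 ^+ N1 :> R by rewrite exprn_gt0.
(* u0 separates small radii, r <= u0 * rho x, from large ones *)
pose u0 := Num.min (Num.min 1 (2 * M * expR eps)^-1) (R0 / 2 ^+ N1).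
have u00 : 0 < u0 by rewrite !lt_min ltr01 invr_gt0 Me divr_gt0.
have u01 : u0 <= 1 by rewrite !ge_min lexx.
have uM : u0 * (2 * M * expR eps) <= 1.
  by rewrite -ler_pdivlMr// div1r !ge_min lexx orbT.
have uN : 2 ^+ N1 * u0 <= R0 by rewrite mulrC -ler_pdivlMr// ge_min lexx orbT.
(* N2 halvings take R0 to a radius of at most u0 / (2 * expR eps) *)
have [N2 hN2] := pow2_ge (R0 * (2 * expR eps / u0)).
have P2 : 0 < 2 ^+ N2 :> R by rewrite exprn_gt0.
have e1 : 1 <= expR eps by rewrite -expR0 ler_expR ltW.
have hN2' : R0 / 2 ^+ N2 * (2 * expR eps / u0) <= 1.
  by rewrite mulrAC ler_pdivrMr// mul1r.
have small : R0 / 2 ^+ N2 <= 1.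
  apply: le_trans hN2'; rewrite ler_peMr ?divr_ge0 ?ltW//.
  by rewrite ltr_pdivlMr// mul1r; lra.
(* the lower bound on rho q / r that the ascent provides *)
pose kappa := expR (- eps) * (4 * radial_const eps)^-1.
have kappa0 : 0 < kappa.
  rewrite mulr_gt0 ?expR_gt0// invr_gt0 mulr_gt0//.
  exact: lt_le_trans (radial_const_ge1 eps0).
pose C1 := expR (2 * (beta * R0)) * Cmu ^+ N1.
pose C2 := 2 * expR (beta * (2 * (1 + M * (3 / kappa) / eps +
     (2 * delta + 3)) + R0 / 2 ^+ N2)) * Cmu ^+ N2.
have C10 : 0 <= C1 by rewrite mulr_ge0 ?expR_ge0 ?exprn_ge0.
have C20 : 0 <= C2 by rewrite !mulr_ge0 ?expR_ge0 ?exprn_ge0.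
exists ((1 + C1 + C2) ^+ 3).
move=> X b omega mu proper geo hyp Hb _ _ GH doub Xbar i compl.
have mp := measurable_preimage_ball eps0 geo Hb compl.
have mono (A B : set (borel X)) : measurable A -> measurable B -> A `<=` B ->
    (\int[mu]_(x in A) (exp_density beta b x)%:E <=
     \int[mu]_(x in B) (exp_density beta b x)%:E)%E.
  move=> mA mB AB; apply: ge0_subset_integral => //.
    by apply: measurable_funTS; apply: borel_expR; exact: busemann_lip.
  by move=> x _; rewrite lee_fin expR_ge0.
have W0 A : (0 <= weighted_measure mu beta b i A)%E.
  by apply: integral_ge0 => x _; rewrite lee_fin expR_ge0.
have le_const c A : c <= 1 + C1 + C2 ->
    (c%:E * weighted_measure mu beta b i A <=
     (1 + C1 + C2)%:E * weighted_measure mu beta b i A)%E.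
  by move=> h; rewrite lee_wpmul2r// lee_fin.
apply: (doubling_dense compl.2); first by lra.
  by move=> y z r s yz; apply: mono => // x; exact: yz.
move=> x r r0.
have [ru|ru] := leP r (u0 * exp_density eps b x).
  apply: le_trans (le_const C1 _ _); last by lra.
  exact: (doubling_small_balls eps0 M1 geo Hb GH compl hR0 doub betaC r0
    hN1 uM uN ru).
have xr : exp_density eps b x <= r / u0.
  by rewrite ler_pdivlMr// mulrC ltW.
have [[q [xq qlow qup]]|all_] :=
  conformal_ascent eps0 geo Hb compl u00 u01 r0 xr.
  apply: le_trans (le_const C2 _ _); last by lra.
  apply: (doubling_large_balls eps0 M1 delta0 geo hyp Hb GH compl hR0 doub
    proper betaC r0 kappa0 xq qlow (k := u0^-1)) => //.
    by rewrite mulrC.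
  rewrite -(ler_pM2l (ltr0Sn R 1)) mulfV// -[leRHS]mul1r mulr1.
  by apply: le_trans hN2'; rewrite le_eqVlt; apply/orP; left; apply/eqP; ring.
apply: le_trans (le_const 1 _ _); last by lra.
rewrite mul1e; apply: mono => // y _.
by rewrite /preimage/= ballEmdist/=.
Qed.
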